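(* Let $n\ge1$. The function $\psi_n:\mathrm{PF}_n\to\mathrm{PF}_n$ is the inverse of $\phi_n:\mathrm{PF}_n\to\mathrm{PF}_n$.
   Context: Let $n\geq 1$ and $[n]=\{1,\dots,n\}$. A parking function of size $n$ is a function $f:[n]\to[n]$ with $|f^{-1}(\{1,\dots,m\})|\ge m$ for all $m\in[n]$; $\mathrm{PF}_n$ is the set of these. Labelled Dyck paths: a labelled $m$-Dyck path is a lattice path from $(0,0)$ to $(m,m)$ with north and east unit steps, never below the diagonal $y=x$, whose north steps are labelled by positive integers so that labels on the same vertical line increase from bottom to top. Throughout, labels are pairwise distinct. For such a path $P$ and a label $\lambda$ of $P$, let $P(\lambda)$ be the column of $\lambda$ (so $P(\lambda)=i$ if the north step labelled $\lambda$ is on the line $x=i-1$), and let $a_\lambda(P)$ be the number of whole unit squares between $P$ and $y=x$ in the row of $\lambda$ (if $\lambda$ is in the $r$-th row from the bottom, $a_\lambda(P)=r-P(\lambda)$). A pair of labels $\{\lambda,\mu\}$ with $\lambda<\mu$ is a diagonal inversion of $P$ if either (A) $P(\lambda)<P(\mu)$ and $a_\lambda(P)=a_\mu(P)$, or (B) $P(\lambda)>P(\mu)$ and $a_\lambda(P)+1=a_\mu(P)$. The set of diagonal inversions is $\mathrm{Dinv}(P)$. Parking functions of size $n$ are identified with labelled $n$-Dyck paths with label set $[n]$, $f$ corresponding to the path in which the labels on the line $x=i-1$ are those in $f^{-1}(i)$. The map $\phi_n$: for $f\in\mathrm{PF}_n$, the dinv reading word of $f$ is the word $w_1w_2\cdots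 w_n$ listing all labels in increasing order with respect to the total order in which $\lambda$ precedes $\mu$ iff $a_\lambda(f)<a_\mu(f)$, or $a_\lambda(f)=a_\mu(f)$ and $f(\lambda)<f(\mu)$. For $\lambda=w_j$ set $d_\lambda(f)=\#\{\{w_i,w_j\}\in\mathrm{Dinv}(f) : i<j\}$. Then $\phi_n:\mathrm{PF}_n\to\mathrm{PF}_n$ is defined by $(\phi_n(f))(w_i)=i-d_{w_i}(f)$ for all $i\in[n]$ (this is indeed a parking function). The pmaj word: for $g\in\mathrm{PF}_n$ the permutation $\sigma_{\mathrm{pmaj}}(g)=\sigma_1\cdots\sigma_n$ (one-line notation) is defined as follows. Set $B_0'=\varnothing$, $\sigma_0=n+1$. For $m=1,\dots,n$: let $B_m=B_{m-1}'\cup g^{-1}(m)$ and $X_m=\{a\in B_m: a<\sigma_{m-1}\}$; put $\sigma_m=\max X_m$ if $X_m\ne\varnothing$ and $\sigma_m=\max B_m$ otherwise; let $B_m'=B_m\setminus\{\sigma_m\}$. For a label $\lambda=\sigma_m$, let $p_\lambda(g)=\#\{i : 1\le i<m,\ \sigma_i<\sigma_{i+1}\}$ and $c_\lambda(g)=g(\lambda)-1$. The map $\psi_n$: for $g\in\mathrm{PF}_n$, start with the empty labelled $0$-Dyck path (the single point $(0,0)$) and perform Steps $m=1,\dots,n$. At Step $m$, given the labelled $(m-1)$-Dyck path $P_{m-1}$ obtained so far (with labels $\sigma_1,\dots,\sigma_{m-1}$), consider the lattice points of $P_{m-1}$ lying on the diagonal $y=x+p_{\sigma_m}(g)$. Inserting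 $\sigma_m$ at such a point means inserting there a north step labelled $\sigma_m$ immediately followed by an east step (the remainder of the path being translated by $(1,1)$). The point is suitable if the result is a labelled $m$-Dyck path. In the resulting path, $\sigma_m$ avoids a diagonal inversion with $\lambda\in\{\sigma_1,\dots,\sigma_{m-1}\}$ if $\{\lambda,\sigma_m\}$ is not a diagonal inversion of it. There is exactly one suitable point at which the insertion makes $\sigma_m$ avoid exactly $c_{\sigma_m}(g)$ diagonal inversions; insert $\sigma_m$ there to get $P_m$. Then $\psi_n(g)\in\mathrm{PF}_n$ is the parking function corresponding to $P_n$. *)

(* Defs.v *)
From HB Require Import structures.
From mathcomp Require Import all_boot.

Set Implicit Arguments.
Unset Strict Implicit.
Unset Printing Implicit Defensive.

(* [n] = {1, ..., n} is modelled by 'I_n = {0, ..., n - 1}: the ordinal i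
   stands for i + 1, both for labels (arguments) and columns (values). *)

Definition parking (n : nat) (f : {ffun 'I_n -> 'I_n}) : bool :=
  [forall m : 'I_n.+1, m <= #|[set i : 'I_n | f i < m]|].

Record PF (n : nat) := Park {
  pf_fun :> {ffun 'I_n -> 'I_n};
  pf_parking : parking pf_fun }.

HB.instance Definition _ (n : nat) := [isSub for @pf_fun n].
HB.instance Definition _ (n : nat) := [Countable of PF n by <:].
HB.instance Definition _ (n : nat) := [Finite of PF n by <:].

(* A lattice path starting at (0,0) is the word of its steps: [Some l] is a
   north step labelled l, [None] is an east step. The lattice points of P are
   its prefixes [take k P], 0 <= k <= size P. *)
Definition lpath (n : nat) := seq (option 'I_n).

Definition xcoord (n : nat) (P : lpath n) (k : nat) : nat :=
  count_mem None (take k P).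

Definition ycoord (n : nat) (P : lpath n) (k : nat) : nat :=
  count isSome (take k P).

Definition labels (n : nat) (P : lpath n) : seq 'I_n := pmap id P.

(* Zero-based column and row of a label of P, i.e. the coordinates of the
   bottom point of its north step. *)
Definition col (n : nat) (P : lpath n) (l : 'I_n) : nat :=
  xcoord P (index (Some l) P).

Definition row (n : nat) (P : lpath n) (l : 'I_n) : nat :=
  ycoord P (index (Some l) P).

Definition area (n : nat) (P : lpath n) (l : 'I_n) : nat := row P l - col P l.

(* Labelled m-Dyck paths with pairwise distinct labels in [n]. *)
Definition labelled_dyck (n m : nat) (P : lpath n) : bool :=
  [&& xcoord P (size P) == m, ycoord P (size P) == m,
      all (fun k => xcoord P k <= ycoord P k) (iota 0 (size P).+1),
      uniq (labels P)
    & all (fun l => all (fun l' =>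
        (col P l == col P l') && (row P l < row P l') ==> (l < l'))
        (labels P)) (labels P)].

Definition dinv_lt (n : nat) (P : lpath n) (l m : 'I_n) : bool :=
  (l < m) && ((col P l < col P m) && (area P l == area P m)
           || (col P l > col P m) && ((area P l).+1 == area P m)).

(* The unordered pair {l, m} belongs to Dinv(P). *)
Definition dinv (n : nat) (P : lpath n) (l m : 'I_n) : bool :=
  [&& l \in labels P, m \in labels P & dinv_lt P l m || dinv_lt P m l].

(* Labels within a column are listed in the increasing order of [enum 'I_n]. *)
Definition path_of (n : nat) (f : {ffun 'I_n -> 'I_n}) : lpath n :=
  flatten [seq rcons [seq Some l | l <- enum 'I_n & f l == i] None
          | i <- enum 'I_n].

Definition precedes (n : nat) (f : {ffun 'I_n -> 'I_n}) (l m : 'I_n) : bool :=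
  (area (path_of f) l < area (path_of f) m)
  || (area (path_of f) l == area (path_of f) m) && (f l < f m).

Definition dinv_word (n : nat) (f : {ffun 'I_n -> 'I_n}) : seq 'I_n :=
  sort (fun l m => (l == m) || precedes f l m) (enum 'I_n).

Definition dinv_before (n : nat) (f : {ffun 'I_n -> 'I_n}) (l : 'I_n) : nat :=
  count (fun m => dinv (path_of f) m l)
    (take (index l (dinv_word f)) (dinv_word f)).

(* With zero-based positions and zero-based columns, the formula i - d_{w_i}
   keeps its shape. *)
Lemma phi_subproof (n : nat) (f : {ffun 'I_n -> 'I_n}) (l : 'I_n) :
  index l (dinv_word f) - dinv_before f l < n.
Proof.
apply: leq_ltn_trans (leq_subr _ _) _.
have sw : size (dinv_word f) = n by rewrite size_sort size_enum_ord.
by rewrite -[X in _ < X]sw index_mem mem_sort mem_enum.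
Qed.

Definition phi_fun (n : nat) (f : {ffun 'I_n -> 'I_n}) : {ffun 'I_n -> 'I_n} :=
  [ffun l => Ordinal (phi_subproof f l)].

Lemma phi_parking (n : nat) (f : PF n) : parking (phi_fun f).
Proof.
apply/forallP=> m; set w := dinv_word f.
have sw : size w = n by rewrite size_sort size_enum_ord.
have uw : uniq (take m w) by rewrite take_uniq // sort_uniq enum_uniq.
have sm : size (take m w) = m by rewrite size_takel // sw -ltnS.
rewrite -[X in X <= _]sm -(card_uniqP uw).
apply/subset_leq_card/subsetP=> l lm; rewrite inE ffunE /=.
apply: leq_ltn_trans (leq_subr _ _) _.
by rewrite -/w -in_take_leq // sw -ltnS.
Qed.

Definition phi (n : nat) (f : PF n) : PF n := Park (phi_parking f).

Definition set_max (n : nat) (A : {set 'I_n}) : option 'I_n :=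
  [pick a in A | [forall b in A, b <= a]].

Definition pmaj_next (n : nat) (s : nat) (B : {set 'I_n}) : option 'I_n :=
  let X := [set a in B | a < s] in
  if X != set0 then set_max X else set_max B.

(* k further letters of the pmaj word, the next column (zero-based) being m,
   the previous letter s and the previous leftover set B'. For parking functions
   the sets B_m are nonempty, so [None] does not occur. *)
Fixpoint pmaj_from (n : nat) (g : {ffun 'I_n -> 'I_n})
    (k m s : nat) (B' : {set 'I_n}) : seq 'I_n :=
  if k is k'.+1 then
    let B := B' :|: [set a | g a == m :> nat] in
    if pmaj_next s B is Some a then a :: pmaj_from g k' m.+1 a (B :\ a)
    else [::]
  else [::].

(* The initial letter sigma_0 = n + 1 is n in zero-based labels. *)
Definition pmaj_word (n : nat) (g : {ffun 'I_n -> 'I_n}) : seq 'I_n :=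
  pmaj_from g n 0 n set0.

(* p_l(g): the number of ascents of the pmaj word up to the letter l. *)
Definition pmaj_asc (n : nat) (g : {ffun 'I_n -> 'I_n}) (l : 'I_n) : nat :=
  let w := pmaj_word g in
  count (fun i => nth l w i < nth l w i.+1) (iota 0 (index l w)).

Definition insert_at (n : nat) (P : lpath n) (l : 'I_n) (k : nat) : lpath n :=
  take k P ++ [:: Some l; None] ++ drop k P.

Definition avoided (n : nat) (P : lpath n) (l : 'I_n) (k : nat) : nat :=
  count (fun l' => ~~ dinv (insert_at P l k) l' l) (labels P).

(* The points at which Step m of psi may insert l = sigma_m. The label l is to
   avoid c_l(g) = g(l) - 1 inversions, which is the zero-based value of g at l. *)
Definition insertion_points (n : nat) (g : {ffun 'I_n -> 'I_n})
    (P : lpath n) (l : 'I_n) : seq nat :=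
  [seq k <- iota 0 (size P).+1
  | [&& ycoord P k == xcoord P k + pmaj_asc g l,
        labelled_dyck (size (labels P)).+1 (insert_at P l k)
      & avoided P l k == g l]].

(* Undefined unless there is exactly one insertion point. *)
Definition psi_step (n : nat) (g : {ffun 'I_n -> 'I_n})
    (P : lpath n) (l : 'I_n) : option (lpath n) :=
  if insertion_points g P l is [:: k] then Some (insert_at P l k) else None.

Definition psi_path (n : nat) (g : {ffun 'I_n -> 'I_n}) : option (lpath n) :=
  foldl (fun oP l => obind (fun P => psi_step g P l) oP) (Some [::])
    (pmaj_word g).

(* psi_n as an a priori partial function: [None] if the construction fails. *)
Definition psi_partial (n : nat) (g : PF n) : option (PF n) :=
  obind (fun P => [pick f : PF n | path_of f == P]) (psi_path g).

(* Main.v *)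
Require Import Defs.
From HB Require Import structures.
From mathcomp Require Import all_boot.
From mathcomp Require Import zify.

Set Implicit Arguments.
Unset Strict Implicit.
Unset Printing Implicit Defensive.

(* It suffices to prove phi (psi g) = g, because PF_n is finite. Inserting a
   north-east pair changes neither the areas of the old labels nor the
   inversions among them. As psi inserts by weakly increasing area, and in
   decreasing order of labels within one area, a new label l of area p can only
   form an inversion with a label of area p or with a smaller label of area
   p - 1, and does so exactly when it is inserted before it. The suitable points
   are those just after such a label (and the origin if p = 0), so the number of
   avoided inversions runs through an interval, once each; the greedy choice in
   the pmaj word puts g(l) - 1 in that interval. In the final path the labels of
   smaller area precede l both in the pmaj word and in the dinv reading word;
   those of area p that precede l and avoid it are, in either word, the larger
   labels to the left of l. Hence phi counts the same g(l) - 1 labels. *)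

(** * Labels and coordinates of lattice paths *)

Lemma mem_labels (n : nat) (P : lpath n) (l : 'I_n) :
  (l \in labels P) = (Some l \in P).
Proof. by rewrite mem_pmap map_id. Qed.

Lemma size_labels (n : nat) (P : lpath n) : size (labels P) = count isSome P.
Proof. exact: size_pmap. Qed.

Lemma labels_cat (n : nat) (A B : lpath n) :
  labels (A ++ B) = labels A ++ labels B.
Proof. exact: pmap_cat. Qed.

Lemma col_cat (n : nat) (A B : lpath n) (l : 'I_n) :
  col (A ++ B) l = if Some l \in A then col A l else count_mem None A + col B l.
Proof.
rewrite /col /xcoord index_cat; case: ifP => _.
  by rewrite takel_cat // index_size.
by rewrite take_cat ltnNge leq_addr /= addKn count_cat.
Qed.

Lemma row_cat (n : nat) (A B : lpath n) (l : 'I_n) :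
  row (A ++ B) l = if Some l \in A then row A l else count isSome A + row B l.
Proof.
rewrite /row /ycoord index_cat; case: ifP => _.
  by rewrite takel_cat // index_size.
by rewrite take_cat ltnNge leq_addr /= addKn count_cat.
Qed.

Lemma col_cons (n : nat) x (B : lpath n) (l : 'I_n) :
  col (x :: B) l = if x == Some l then 0 else (x == None) + col B l.
Proof. by rewrite /col /xcoord /=; case: eqP. Qed.

Lemma row_cons (n : nat) x (B : lpath n) (l : 'I_n) :
  row (x :: B) l = if x == Some l then 0 else isSome x + row B l.
Proof. by rewrite /row /ycoord /=; case: eqP. Qed.

Lemma col_le (n : nat) (P : lpath n) (l : 'I_n) : col P l <= count_mem None P.
Proof.
rewrite /col /xcoord.
by rewrite -[in leqRHS](cat_take_drop (index (Some l) P) P) count_cat leq_addr.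
Qed.

Lemma row_lt (n : nat) (P : lpath n) (l : 'I_n) :
  Some l \in P -> row P l < count isSome P.
Proof.
elim: P => // x P IH; rewrite inE row_cons eq_sym /=; case: eqP => [-> //|_] /=.
by move=> /IH; rewrite ltn_add2l.
Qed.

(** * Labelled Dyck paths described by local conditions *)

Definition column_step (n : nat) (x y : option 'I_n) : bool :=
  if x is Some l then if y is Some m then l < m else true else true.

(** A form of [labelled_dyck] suited to insertion: labels are compared only between consecutive
    north steps, which is where an insertion can do damage. *)
Definition valid_path (n : nat) (P : lpath n) : Prop :=
  [/\ count_mem None P = count isSome P,
      forall k, xcoord P k <= ycoord P k,
      uniq (labels P)
    & sorted (@column_step n) P].

Lemma valid_prefix (n : nat) (A B : lpath n) :
  valid_path (A ++ B) -> count_mem None A <= count isSome A.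
Proof.
by case=> _ /(_ (size A)) + _ _; rewrite /xcoord /ycoord take_size_cat.
Qed.

Lemma valid_col_row (n : nat) (P : lpath n) (l : 'I_n) :
  valid_path P -> col P l <= row P l.
Proof. by case=> _ pre _ _; apply: pre. Qed.

Lemma path_column (n : nat) (l l' : 'I_n) (C B : lpath n) :
  None \notin C -> path (@column_step n) (Some l) (C ++ Some l' :: B) -> l < l'.
Proof.
elim: C l => [|[x|] C IH] l //=; first by move=> _ /andP[].
by rewrite inE /= => nC /andP[lx /(IH _ nC)]; apply: ltn_trans.
Qed.

Lemma label_split (n : nat) (P : lpath n) (l : 'I_n) :
  uniq (labels P) -> Some l \in P ->
  exists A B, P = A ++ Some l :: B /\ Some l \notin A.
Proof.
move=> + lP; case/splitPr: lP => A B; rewrite labels_cat cat_uniq /=.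
case/and3P=> _ /norP[nA _] _; exists A, B; split=> //.
by rewrite -mem_labels.
Qed.

(** Two labels of one column have no east step between them, so the local comparisons chain along
    the run of north steps joining them. *)
Lemma valid_labelled_dyck (n : nat) (P : lpath n) :
  valid_path P -> labelled_dyck (size (labels P)) P.
Proof.
move=> [eqc pre un so]; rewrite /labelled_dyck /xcoord /ycoord !take_size.
rewrite size_labels eqc eqxx un !andTb; apply/andP; split.
  by apply/allP => k _; apply: pre.
apply/allP => l lP; apply/allP => l' l'P; apply/implyP => /andP[/eqP eqcol ltr].
rewrite mem_labels in lP; rewrite mem_labels in l'P.
have [A [B [defP nA]]] := label_split un lP.
have uB : uniq (labels B).
  by move: un; rewrite defP labels_cat cat_uniq => /and3P[_ _ /andP[]].
move: eqcol ltr l'P so; rewrite {}defP !col_cat !row_cat (negPf nA).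
rewrite !col_cons !row_cons eqxx !addn0.
case: ifP => l'A; first by have := row_lt l'A; lia.
rewrite mem_cat l'A inE [Some l' == _]eq_sym; case: eqP => [_|_] /=; first lia.
move=> + _ l'B; have [C [D [-> nC]]] := label_split uB l'B.
rewrite col_cat (negPf nC) col_cons eqxx => eqcol so.
apply: (path_column (C:=C) (B:=D)).
  by rewrite -has_pred1 has_count; lia.
by move: so; case: A {nA l'A eqcol} => //= x A; rewrite cat_path /= => /and3P[].
Qed.

(** * Inserting a north-east pair into a path *)

Lemma insert_at_cat (n : nat) (A B : lpath n) (l : 'I_n) :
  insert_at (A ++ B) l (size A) = A ++ [:: Some l; None] ++ B.
Proof. by rewrite /insert_at take_size_cat // drop_size_cat. Qed.

Lemma labels_insert (n : nat) (A B : lpath n) (l : 'I_n) :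
  labels (A ++ [:: Some l; None] ++ B) = labels A ++ l :: labels B.
Proof. by rewrite !labels_cat. Qed.

Lemma col_insert (n : nat) (A B : lpath n) (l x : 'I_n) :
  x != l -> col (A ++ [:: Some l; None] ++ B) x =
    col (A ++ B) x + (Some x \notin A).
Proof.
move=> xl; rewrite !(col_cat A); case: ifP => xA /=; first by rewrite addn0.
have /negPf lx : Some l != Some x by apply: contraNneq xl => -[->].
by rewrite !col_cons lx /=; lia.
Qed.

Lemma row_insert (n : nat) (A B : lpath n) (l x : 'I_n) :
  x != l -> row (A ++ [:: Some l; None] ++ B) x =
    row (A ++ B) x + (Some x \notin A).
Proof.
move=> xl; rewrite !(row_cat A); case: ifP => xA /=; first by rewrite addn0.
have /negPf lx : Some l != Some x by apply: contraNneq xl => -[->].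
by rewrite !row_cons lx /=; lia.
Qed.

Lemma area_insert (n : nat) (A B : lpath n) (l x : 'I_n) :
  x != l -> area (A ++ [:: Some l; None] ++ B) x = area (A ++ B) x.
Proof.
by move=> xl; rewrite /area col_insert // row_insert // subnDr.
Qed.

Lemma col_inserted (n : nat) (A B : lpath n) (l : 'I_n) :
  Some l \notin A -> col (A ++ [:: Some l; None] ++ B) l = count_mem None A.
Proof. by move/negPf=> lA; rewrite col_cat lA col_cons eqxx addn0. Qed.

Lemma row_inserted (n : nat) (A B : lpath n) (l : 'I_n) :
  Some l \notin A -> row (A ++ [:: Some l; None] ++ B) l = count isSome A.
Proof. by move/negPf=> lA; rewrite row_cat lA row_cons eqxx addn0. Qed.

Lemma area_inserted (n : nat) (A B : lpath n) (l : 'I_n) :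
  Some l \notin A -> area (A ++ [:: Some l; None] ++ B) l =
    count isSome A - count_mem None A.
Proof. by move=> lA; rewrite /area row_inserted // col_inserted. Qed.

(** The insertion can change the comparison of two columns only for labels u before and v after the
    point with equal columns. Then u has the smaller row, hence the smaller area, and u, v form no
    inversion either before or after the insertion. *)
Lemma dinv_insert (n : nat) (A B : lpath n) (l x y : 'I_n) :
  valid_path (A ++ B) -> x != l -> y != l ->
  dinv (A ++ [:: Some l; None] ++ B) x y = dinv (A ++ B) x y.
Proof.
move=> vP.
have side (u v : 'I_n) : Some u \in A -> Some v \notin A ->
    col (A ++ B) u <= col (A ++ B) v /\ row (A ++ B) u < row (A ++ B) v.
  move=> uA /negPf vA; rewrite !(col_cat A) !(row_cat A) uA vA.
  by split; [have := col_le A u | have := row_lt uA]; lia.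
have dinv_ltE (u v : 'I_n) : u != l -> v != l ->
    dinv_lt (A ++ [:: Some l; None] ++ B) u v = dinv_lt (A ++ B) u v.
  move=> ul vl; rewrite /dinv_lt !area_insert // !col_insert // /area.
  have := valid_col_row u vP; have := valid_col_row v vP.
  have := side u v; have := side v u.
  case: (Some u \in A) => /=; case: (Some v \in A) => /= => H1 H2.
  - lia.
  - by have := H2 isT isT; lia.
  - by have := H1 isT isT; lia.
  - lia.
move=> xl yl; rewrite /dinv !dinv_ltE // labels_insert labels_cat.
by rewrite !mem_cat !inE (negPf xl) (negPf yl).
Qed.

(* The labels that can form a diagonal inversion with a new label l of area p,
   when the labels of area p already present all exceed l. *)
Definition good (n : nat) (P : lpath n) (p : nat) (l x : 'I_n) : bool :=
  (area P x == p) || ((area P x).+1 == p) && (x < l).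

(** Since no area exceeds p, either kind of inversion requires x strictly to the right of l. The
    inserted east step puts all later labels there, while earlier labels are never strictly to the
    right. *)
Lemma dinv_inserted (n : nat) (A B : lpath n) (l x : 'I_n) p :
    valid_path (A ++ B) -> l \notin labels (A ++ B) ->
    count isSome A = count_mem None A + p ->
    (forall y, y \in labels (A ++ B) ->
      area (A ++ B) y <= p /\ (area (A ++ B) y = p -> l < y)) ->
  x \in labels (A ++ B) ->
  dinv (A ++ [:: Some l; None] ++ B) x l =
    good (A ++ B) p l x && (x \notin labels A).
Proof.
move=> vP nl ht top xP.
have xl : x != l by apply: contraNneq nl => <-.
have lA : Some l \notin A.
  by move: nl; rewrite labels_cat mem_cat mem_labels; case/norP.
rewrite /dinv !labels_insert !mem_cat !inE eqxx orbT /=.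
have -> : [|| x \in labels A, x == l | x \in labels B].
  move: xP; rewrite labels_cat mem_cat.
  by case: (x \in labels A) => //= ->; lia.
have [ap al] := top x xP.
rewrite mem_labels /dinv_lt !(area_insert _ _ xl) !(col_insert _ _ xl) /good.
rewrite area_inserted // col_inserted // ht addKn.
have -> : (col (A ++ B) x + (Some x \notin A) < count_mem None A)
    = (Some x \in A) && (col A x < count_mem None A).
  by rewrite col_cat; case: (Some x \in A) => //=; lia.
have -> : (count_mem None A < col (A ++ B) x + (Some x \notin A))
    = (Some x \notin A).
  by rewrite col_cat; have := col_le A x; case: (Some x \in A) => /=; lia.
move: al; have : (x : nat) != l by [].
case: (Some x \in A) => /=; lia.
Qed.

Lemma avoided_insert (n : nat) (A B : lpath n) (l : 'I_n) p :
    valid_path (A ++ B) -> l \notin labels (A ++ B) ->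
    count isSome A = count_mem None A + p ->
    (forall y, y \in labels (A ++ B) ->
      area (A ++ B) y <= p /\ (area (A ++ B) y = p -> l < y)) ->
  avoided (A ++ B) l (size A) =
    count (good (A ++ B) p l) (labels A)
    + count (fun x => ~~ good (A ++ B) p l x) (labels (A ++ B)).
Proof.
move=> vP nl ht top; have [_ _ un _] := vP.
rewrite /avoided insert_at_cat.
under eq_in_count => x xP do rewrite (dinv_inserted vP nl ht top xP) negb_and.
rewrite labels_cat in un *; rewrite !count_cat addnA; congr (_ + _).
  rewrite [RHS]count_predC -(count_predT (labels A)).
  by apply: eq_in_count => x xA; rewrite xA orbT.
move: un; rewrite cat_uniq => /and3P[_ /hasPn nA _].
by apply: eq_in_count => x /nA /= ->; rewrite orbF.
Qed.

(** The only new constraint is between the last step of A and l: the inserted east step leaves the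
    first step of B unconstrained. *)
Lemma valid_insert (n : nat) (A B : lpath n) (l : 'I_n) :
  valid_path (A ++ B) -> l \notin labels (A ++ B) ->
  column_step (last None A) (Some l) ->
  valid_path (A ++ [:: Some l; None] ++ B).
Proof.
move=> [eqc pre un so] nl step; split.
- by move: eqc; rewrite !count_cat /=; lia.
- move=> k; case: (leqP k (size A)) => [kA|Ak].
    by move: (pre k); rewrite /xcoord /ycoord !takel_cat.
  rewrite -(subnKC (ltnW Ak)).
  case: (k - size A) (subn_gt0 (size A) k) => [|j _].
    by rewrite Ak.
  (* For j = 0 the new prefix ends with the inserted north step. Otherwise it contains the whole
     pair and comes from the old prefix of length [size A + j.-1]. *)
  have := pre (size A + j.-1); have := pre (size A).
  rewrite /xcoord /ycoord !take_cat !ltnNge !leq_addr leqnn /= !addKn !subnn.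
  rewrite take0 cats0; case: j => [|j] /=.
    by rewrite take0 !count_cat /=; lia.
  by rewrite !subSS subn0 !count_cat /=; lia.
- have perm : perm_eq (l :: labels A ++ labels B) (labels A ++ l :: labels B).
    by rewrite -cat1s perm_catCA.
  by rewrite labels_insert -(perm_uniq perm) -labels_cat /= nl.
- have rest y : path (@column_step n) y B -> path (@column_step n) None B.
    by case: B {eqc pre un so nl} => //= z B /andP[_].
  case: A so step {eqc pre un nl} => [|x A] /=.
    by case: B {rest}.
  by rewrite !cat_path => /andP[-> /rest /= ->] ->.
Qed.

(** * Existence and uniqueness of the insertion point *)

Lemma area_split (n : nat) (A B : lpath n) (x : 'I_n) :
  valid_path (A ++ Some x :: B) ->
  area (A ++ Some x :: B) x = count isSome A - count_mem None A.
Proof.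
case=> _ _ + _; rewrite labels_cat cat_uniq /= => /and3P[_ /norP[xA _] _].
rewrite mem_labels in xA.
by rewrite /area row_cat col_cat (negPf xA) row_cons col_cons eqxx !addn0.
Qed.

(** The last north step of the prefix starts at a height equal to its area, at most p, and ends one
    higher; later east steps only descend. *)
Lemma prefix_height (n : nat) (A B : lpath n) p :
  valid_path (A ++ B) ->
  (forall y, y \in labels (A ++ B) -> area (A ++ B) y <= p) ->
  count isSome A <= count_mem None A + p.+1.
Proof.
elim/last_ind: A B => // A [x|] IH B; rewrite cat_rcons -cats1 => vP top.
  have := top x; rewrite area_split // mem_labels mem_cat inE eqxx orbT.
  have := valid_prefix vP; rewrite !count_cat /=; lia.
by have := IH _ vP top; rewrite !count_cat /=; lia.
Qed.

(** The end of C decides. A final north step x has area p - 1 and is smaller than l; a final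
    north-east pair has a label of area p; two final east steps would start at height p + 2, above
    the maximum p + 1. *)
Lemma suitable_after_good (n : nat) (A C B : lpath n) (l : 'I_n) p :
    valid_path (A ++ C ++ B) ->
    (forall y, y \in labels (A ++ C ++ B) -> area (A ++ C ++ B) y <= p) ->
    C != [::] ->
    count isSome A = count_mem None A + p ->
    count isSome C = count_mem None C ->
    column_step (last None C) (Some l) ->
  has (good (A ++ C ++ B) p l) (labels C).
Proof.
case/lastP: C => // C [x|] vP top _ hA hC.
  rewrite last_rcons /= => xl; apply/hasP; exists x.
    by rewrite mem_labels mem_rcons inE eqxx.
  move: hC; rewrite /good cat_rcons catA in vP top *.
  rewrite area_split //; have := valid_prefix vP.
  by move: hA; rewrite xl -cats1 !count_cat /=; lia.
case/lastP: C hC vP top => [|C [x|]]; first by [].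
  move=> hC vP top _; apply/hasP; exists x.
    by rewrite mem_labels mem_rcons inE mem_rcons inE eqxx orbT.
  move: hC; rewrite /good !cat_rcons catA in vP top *.
  rewrite area_split //; have := valid_prefix vP.
  by move: hA; rewrite -!cats1 !count_cat /=; lia.
rewrite !cat_rcons catA => hC vP top.
have := prefix_height vP top; move: hC.
by move: hA; rewrite -!cats1 !count_cat /=; lia.
Qed.

(** The converse of [valid_insert]: together they characterize the suitable points of a diagonal by
    the step just before them. *)
Lemma labelled_dyck_insert_step (n m : nat) (A B : lpath n) (l : 'I_n) :
  labelled_dyck m (A ++ [:: Some l; None] ++ B) ->
  column_step (last None A) (Some l).
Proof.
case/lastP: A => // A [x|]; rewrite last_rcons // cat_rcons => /and5P[_ _ _].
move=> un; have [xA [lA xl]] : Some x \notin A /\ Some l \notin A /\ x != l.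
  move: un; rewrite labels_cat cat_uniq /= !inE !negb_or.
  by rewrite -!mem_labels => /and3P[_ /and3P[-> -> _] /andP[/andP[-> _] _]].
move/allP/(_ x); rewrite mem_labels mem_cat inE eqxx orbT => /(_ isT).
move/allP/(_ l); rewrite mem_labels mem_cat !inE eqxx !orbT => /(_ isT).
have /negPf xl' : Some x != Some l by apply: contraNneq xl => -[->].
rewrite !(col_cat A) !(row_cat A) (negPf xA) (negPf lA) !col_cons !row_cons.
by rewrite xl' !eqxx /= !addn0 addn1 ltnSn.
Qed.

Lemma split_count (T : Type) (a : pred T) (s : seq T) q :
  q < count a s -> exists s1 x s2, [/\ s = s1 ++ x :: s2, a x & count a s1 = q].
Proof.
elim: s q => //= x s IH q; case: (boolP (a x)) => ax.
  case: q => [|q] lt; first by exists [::], x, s.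
  have [s1 [y [s2 [-> ay <-]]]] := IH q lt.
  by exists (x :: s1), y, s2; rewrite /= ax.
move=> /IH [s1 [y [s2 [-> ay <-]]]].
by exists (x :: s1), y, s2; rewrite /= (negPf ax).
Qed.

Lemma filter_unique (T : eqType) (a : pred T) (s : seq T) x :
  uniq s -> x \in s -> a x -> (forall y, y \in s -> a y -> y = x) ->
  filter a s = [:: x].
Proof.
move=> us xs ax ux; rewrite -(filter_pred1_uniq us xs).
apply: eq_in_filter => y ys; apply/idP/eqP => [/(ux _ ys)|->] //.
Qed.

Lemma count_labels (n : nat) (a : pred 'I_n) (P : lpath n) :
  count (oapp a false) P = count a (labels P).
Proof. by elim: P => //= -[x|] P /= ->. Qed.

(** A good label lies between the two points, so the number of avoided inversions strictly increases
    from one suitable point to the next. This yields uniqueness. *)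
Lemma count_good_lt (n : nat) (P A1 B1 A2 B2 : lpath n) (l : 'I_n) p :
    valid_path P -> (forall y, y \in labels P -> area P y <= p) ->
    P = A1 ++ B1 -> P = A2 ++ B2 -> size A1 < size A2 ->
    count isSome A1 = count_mem None A1 + p ->
    count isSome A2 = count_mem None A2 + p ->
    column_step (last None A2) (Some l) ->
  count (good P p l) (labels A1) < count (good P p l) (labels A2).
Proof.
move=> vP top def1 def2 lt12 h1 h2 step.
have def : A2 = A1 ++ drop (size A1) A2.
  rewrite -[LHS](cat_take_drop (size A1)); congr (_ ++ _).
  have := congr1 (take (size A1)) def2.
  by rewrite {1}def1 take_size_cat ?takel_cat // ltnW.
have : drop (size A1) A2 != [::].
  by rewrite -size_eq0 size_drop subn_eq0 -ltnNge.
move: (drop _ _) def => C defA2 C0; rewrite {}defA2 in def2 lt12 h2 step *.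
rewrite -catA in def2; rewrite labels_cat count_cat -[leqLHS]addn1 leq_add2l.
rewrite -has_count def2.
apply: (@suitable_after_good _ A1 C B2 l p); rewrite -?def2 //.
  by move: h1 h2; rewrite !count_cat /=; lia.
by move: step C0; rewrite last_cat; case: (C).
Qed.

(** The K labels that are not good are avoided at every point. The points belonging to the
    successive good labels avoid K + 1, K + 2, and so on up to all labels; for p = 0 one has K = 0,
    and the origin realizes the value 0. *)
Lemma unique_insertion (n : nat) (P : lpath n) (l : 'I_n) p c :
    valid_path P -> l \notin labels P ->
    (forall y, y \in labels P -> area P y <= p /\ (area P y = p -> l < y)) ->
    c <= size (labels P) ->
    p = 0 \/ count (fun x => ~~ good P p l x) (labels P) < c ->
  exists A B, [/\ P = A ++ B, count isSome A = count_mem None A + p,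
    column_step (last None A) (Some l), avoided P l (size A) = c
  & [seq k <- iota 0 (size P).+1
    | [&& ycoord P k == xcoord P k + p,
          labelled_dyck (size (labels P)).+1 (insert_at P l k)
        & avoided P l k == c]] = [:: size A]].
Proof.
move=> vP nl top cle pc; set K := count _ _ in pc.
have topl y : y \in labels P -> area P y <= p by case/top.
have avE A B : P = A ++ B -> count isSome A = count_mem None A + p ->
    avoided P l (size A) = count (good P p l) (labels A) + K.
  move=> defP hA; move: vP nl top; rewrite /K {}defP => vP nl top.
  by apply: avoided_insert.
have KE : count (good P p l) (labels P) + K = size (labels P).
  exact: count_predC.
have [A [B [defP hA step cA]]] : exists A B,
    [/\ P = A ++ B, count isSome A = count_mem None A + p,
        column_step (last None A) (Some l)
      & count (good P p l) (labels A) + K = c].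
  case: (ltnP K c) => [ltKc|leKc]; last first.
    have p0 : p = 0 by case: pc => //; rewrite ltnNge leKc.
    have K0 : K = 0.
      apply/eqP; rewrite -leqn0 leqNgt -has_count; apply/hasPn => y /topl.
      by rewrite /good p0 leqn0 negbK => ->.
    by exists [::], P; split=> //=; rewrite ?p0 // K0; lia.
  (* The label x is the (c - K)-th good one, so exactly c - K - 1 good labels precede it. *)
  have : c - K.+1 < count (good P p l) (labels P) by lia.
  rewrite -count_labels => /split_count [A [o [B [defP gx]]]].
  case: o gx defP => [x|//] /= gx defP; rewrite count_labels => cA.
  have [ltx|ax] : area P x < p \/ area P x = p.
  - have := topl x; rewrite defP mem_labels mem_cat inE eqxx orbT.
    by move=> /(_ isT); lia.
  (* Here x has area p - 1 and x < l: the top of its north step has height p, and l may stand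
     directly above x. *)
  - exists (A ++ [:: Some x]), B; rewrite -catA; split=> //.
    + have := area_split (A := A) (B := B) (x := x); rewrite -defP => /(_ vP).
      move: gx vP; rewrite /good /= [in valid_path _]defP => gx /valid_prefix.
      by rewrite !count_cat /=; lia.
    + by rewrite last_cat; move: gx; rewrite /good /=; lia.
    + by rewrite labels_cat count_cat /= gx; lia.
  have hA : count isSome A = count_mem None A + p.
    have := area_split (A := A) (B := B) (x := x); rewrite -defP => /(_ vP).
    by move: vP; rewrite [in valid_path _]defP ax => /valid_prefix; lia.
  (* The north step of x now ends at height p + 1. The path cannot stop there, and a further north
     step would have area p + 1, so an east step follows; the point after it is chosen. *)
  case: B defP => [|[y|] B] defP.
  - by case: vP => + _ _ _; rewrite defP !count_cat hA /=; lia.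
  - have yP : y \in labels P.
      by rewrite defP mem_labels mem_cat !inE eqxx !orbT.
    have := area_split (A := A ++ [:: Some x]) (B := B) (x := y).
    rewrite -catA -defP => /(_ vP); have := topl y yP.
    by rewrite !count_cat hA /=; lia.
  exists (A ++ [:: Some x; None]), B; rewrite -catA; split=> //.
  - by rewrite !count_cat hA /=; lia.
  - by rewrite last_cat.
  - by rewrite labels_cat count_cat /= gx; lia.
exists A, B; split=> //; first by rewrite (avE _ _ defP).
have sA : size A <= size P by rewrite defP size_cat leq_addr.
have takeA : take (size A) P = A by rewrite defP take_size_cat.
apply: filter_unique => [|||k]; rewrite ?iota_uniq //.
- by rewrite mem_iota /= add0n ltnS.
- rewrite (avE _ _ defP hA) cA eqxx andbT /xcoord /ycoord takeA hA eqxx /=.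
  rewrite defP insert_at_cat.
  have := @valid_insert _ A B l; rewrite -defP => /(_ vP nl step).
  move/valid_labelled_dyck; rewrite labels_insert defP labels_cat.
  by rewrite !size_cat /= addnS.
rewrite mem_iota add0n ltnS => /= kP /and3P[/eqP hk dk /eqP ak].
have sk : size (take k P) = k by rewrite size_takel.
have stepk : column_step (last None (take k P)) (Some l).
  exact: labelled_dyck_insert_step dk.
move: ak; rewrite -{1}sk (avE _ (drop k P)) ?cat_take_drop // => ck.
case: (ltngtP k (size A)) => // lt.
- have := @count_good_lt _ P (take k P) (drop k P) A B l p vP topl.
  by rewrite cat_take_drop sk => /(_ erefl defP lt hk hA step); lia.
have := @count_good_lt _ P A B (take k P) (drop k P) l p vP topl.
by rewrite cat_take_drop sk => /(_ defP erefl lt hA hk stepk); lia.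
Qed.

(** * The greedy rule of the pmaj word *)

Lemma set_maxP (n : nat) (A : {set 'I_n}) :
  A != set0 -> exists a, [/\ set_max A = Some a, a \in A
                           & forall b, b \in A -> b <= a].
Proof.
case/set0Pn=> a0 a0A; rewrite /set_max.
case: pickP => [a /andP[aA /forallP mx]|none].
  by exists a; split=> // b bA; have /implyP := mx b; apply.
case: (arg_maxnP (fun i : 'I_n => i : nat) a0A) => a aA mx.
have := none a; rewrite [a \in A]aA /= => /negP[].
by apply/forallP => b; apply/implyP => /mx.
Qed.

(** The rule is expressed from the viewpoint of an arbitrary competitor b of the chosen letter a,
    the form in which it constrains letters that are placed later. *)
Lemma pmaj_nextP (n s : nat) (B : {set 'I_n}) :
  B != set0 -> exists a, [/\ pmaj_next s B = Some a, a \in B,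
    forall b, b \in B -> b < s -> b <= a < s
    & forall b, b \in B -> s <= b -> (a < s) || (b <= a)].
Proof.
move=> B0; rewrite /pmaj_next; case: (eqVneq _ set0) => [X0|/set_maxP].
  have [a [-> aB mx]] := set_maxP B0; exists a; split=> // b bB.
    by move=> bs; have := in_set0 b; rewrite -X0 inE bB bs.
  by move=> _; rewrite (mx b bB) orbT.
case=> a [-> + mx]; rewrite inE => /andP[aB as_]; exists a; split=> //.
  by move=> b bB bs; rewrite as_ andbT mx // inE bB.
by rewrite as_.
Qed.

(** The cardinality hypothesis says that m of the labels with value below m are already placed. In
    the last clause r is the letter before position t, and the letter at j, already available at
    step t, lost to the letter at t. *)
Lemma pmaj_from_spec (n : nat) (g : {ffun 'I_n -> 'I_n}) (x0 : 'I_n)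
    (k m s : nat) (B : {set 'I_n}) :
    parking g -> m + k = n -> (forall a, a \in B -> g a < m) ->
    #|B| + m = #|[set i | g i < m]| ->
  let w := pmaj_from g k m s B in
  [/\ size w = k, uniq w,
      forall j, j < k ->
        (nth x0 w j \in B) || (m <= g (nth x0 w j)) /\ g (nth x0 w j) <= m + j
    & forall t j, t < j < k -> g (nth x0 w j) <= m + t ->
        let r := nth 0 (s :: map val w) t in
        (nth x0 w j < r -> nth x0 w j < nth x0 w t < r)
        /\ (r <= nth x0 w j ->
            (nth x0 w t < r) || (nth x0 w j < nth x0 w t))].
Proof.
move=> gP; elim: k m s B => [|k IH] m s B mk Bm cB /=.
  by split=> // t j /andP[].
set B1 := B :|: _.
have cB1 : #|B1| + m = #|[set i | g i < m.+1]|.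
  have -> : [set i | g i < m.+1] =
      [set i | g i < m] :|: [set i | g i == m :> nat].
    by apply/setP => i; rewrite !inE ltnS leq_eqVlt orbC.
  rewrite /B1 !cardsU -cB.
  have -> : B :&: [set a | g a == m :> nat] = set0.
    by apply/setP => i; rewrite !inE; apply/negbTE/andP => -[/Bm + /eqP]; lia.
  have -> : [set i | g i < m] :&: [set a | g a == m :> nat] = set0.
    by apply/setP => i; rewrite !inE; lia.
  by rewrite cards0 !subn0 addnAC.
have mn : m.+1 < n.+1 by lia.
(* The parking condition at m + 1 forces at least one available letter. *)
have := forallP gP (Ordinal mn); rewrite /= -cB1 => cB1m.
have B10 : B1 != set0 by rewrite -card_gt0; lia.
have [a [-> aB1 below above]] := pmaj_nextP s B10.
have Bg b : b \in B1 -> (b \in B) || (m <= g b) /\ g b <= m.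
  by rewrite !inE => /orP[bB|/eqP ->];
    rewrite ?bB ?(ltnW (Bm _ bB)) ?leqnn ?orbT.
have B2m b : b \in B1 :\ a -> g b < m.+1 by rewrite inE => /andP[_ /Bg[]].
have cB2 : #|B1 :\ a| + m.+1 = #|[set i | g i < m.+1]|.
  by rewrite -cB1 (cardsD1 a B1) aB1 addnS.
have mk1 : m.+1 + k = n by rewrite -mk addnS.
have := IH m.+1 a (B1 :\ a) mk1 B2m cB2.
set w := pmaj_from _ _ _ _ _ => -[sw uw memw ordw].
split=> [||[|j] jk|[|t] [|j] //=].
- by rewrite /= sw.
- rewrite /= uw andbT; apply/negP => /(nthP x0)[j]; rewrite sw => jk ja.
  have [+ _] := memw j jk; rewrite ja !inE eqxx /=.
  by have [_] := Bg a aB1; lia.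
- by have [H1 H2] := Bg a aB1; rewrite /= addn0.
- have [H1 H2] := memw j jk; split=> /=; last by lia.
  case/orP: H1 => [|/ltnW ->]; last by rewrite orbT.
  by rewrite inE => /andP[_ /Bg[]].
(* A later letter of value at most m must be in [B1 :\ a], hence it competed with [a]. *)
- move=> jk; rewrite addn0 => gm.
  have [+ _] := memw j jk; rewrite leqNgt ltnS gm orbF => /setD1P[xa xB].
  have xa' : (nth x0 w j : nat) != a by [].
  have := below _ xB; have := above _ xB; lia.
- rewrite ltnS => tjk gm; apply: ordw => //; lia.
Qed.

(** * Ascents of the pmaj word, indexed by position *)

Definition ascents (n : nat) (x0 : 'I_n) (w : seq 'I_n) (k : nat) : nat :=
  count (fun i => nth x0 w i < nth x0 w i.+1) (iota 0 k).

Lemma ascentsS (n : nat) (x0 : 'I_n) (w : seq 'I_n) (k : nat) :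
  ascents x0 w k.+1 = ascents x0 w k + (nth x0 w k < nth x0 w k.+1).
Proof. by rewrite /ascents -addn1 iotaD count_cat /= addn0 add0n addn1. Qed.

Lemma ascents_mono (n : nat) (x0 : 'I_n) (w : seq 'I_n) (j k : nat) :
  j <= k -> ascents x0 w j <= ascents x0 w k.
Proof.
elim: k => [|k IH]; first by rewrite leqn0 => /eqP->.
by rewrite leq_eqVlt ltnS ascentsS => /predU1P[->|/IH];
  rewrite ?ascentsS //; lia.
Qed.

Lemma nth_ord_neq (n : nat) (x0 : 'I_n) (w : seq 'I_n) (j k : nat) :
  uniq w -> j < size w -> k < size w -> j != k ->
  (nth x0 w j : nat) != nth x0 w k.
Proof. by move=> uw jw kw; rewrite -(nth_uniq x0 jw kw uw). Qed.

(** Equal ascent numbers mean that no ascent occurs between the two positions, so the word decreases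
    there. *)
Lemma ascents_eq_desc (n : nat) (x0 : 'I_n) (w : seq 'I_n) (j k : nat) :
  uniq w -> j < k -> k < size w -> ascents x0 w j = ascents x0 w k ->
  nth x0 w k < nth x0 w j.
Proof.
move=> uw; elim: k => // k IH; rewrite ltnS leq_eqVlt ascentsS => jk kw eqa.
have neq : (nth x0 w k : nat) != nth x0 w k.+1.
  by apply: nth_ord_neq => //; lia.
case/predU1P: jk eqa => [->|jk] eqa; first by lia.
have := ascents_mono x0 w (ltnW jk).
by have := IH jk (ltnW kw); lia.
Qed.

Lemma pmaj_asc_nth (n : nat) (g : {ffun 'I_n -> 'I_n}) (x0 : 'I_n) (j : nat) :
  uniq (pmaj_word g) -> j < size (pmaj_word g) ->
  pmaj_asc g (nth x0 (pmaj_word g) j) = ascents x0 (pmaj_word g) j.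
Proof.
move=> uw jw; rewrite /pmaj_asc /ascents index_uniq //.
apply: eq_in_count => i; rewrite mem_iota add0n /= => ij.
by rewrite !(set_nth_default x0) //; lia.
Qed.

Lemma pmaj_wordP (n : nat) (g : PF n) (x0 : 'I_n) :
  let w := pmaj_word g in
  [/\ size w = n, uniq w,
      forall j, j < n -> g (nth x0 w j) <= j
    & forall t j, t < j < n -> g (nth x0 w j) <= t ->
        let r := nth 0 (n :: map val w) t in
        (nth x0 w j < r -> nth x0 w j < nth x0 w t < r)
        /\ (r <= nth x0 w j ->
            (nth x0 w t < r) || (nth x0 w j < nth x0 w t))].
Proof.
have Bm a : a \in set0 -> g a < 0 by rewrite inE.
have cB : #|set0 : {set 'I_n}| + 0 = #|[set i | g i < 0]|.
  suff -> : [set i | g i < 0] = set0 by rewrite addn0.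
  by apply/setP => i; rewrite !inE.
have [sw uw memw ordw] :=
  @pmaj_from_spec n g x0 n 0 n set0 (pf_parking g) (erefl n) Bm cB.
by split=> // j /memw[].
Qed.

(* Let t be the first index whose letter can form an inversion with w_j. If
   g(w_j) <= t, then w_j was available at step t, and the greedy rule either
   makes t - 1 such an index too or forbids the ascent just before w_t. *)
Lemma pmaj_value_gt (n : nat) (g : PF n) (x0 : 'I_n) (j : nat) :
  let w := pmaj_word g in let p := ascents x0 w j in
  j < n -> 0 < p ->
  count (fun i => ~~ ((ascents x0 w i == p)
      || ((ascents x0 w i).+1 == p) && (nth x0 w i < nth x0 w j)))
    (iota 0 j) < g (nth x0 w j).
Proof.
move=> w p jn p0; have [sw uw gw ordw] := pmaj_wordP g x0.
rewrite -/w in sw uw gw ordw.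
pose G i := (ascents x0 w i == p)
  || ((ascents x0 w i).+1 == p) && (nth x0 w i < nth x0 w j).
rewrite -[X in count X]/(fun i => ~~ G i).
(* The index j - 1 qualifies: after a descent to w_j it has p ascents, after an ascent it has p - 1
   and a smaller letter. *)
have exG : exists i, (i < j) && G i.
  exists j.-1; case: j jn @p p0 @G => // j jn p p0 G.
  rewrite ltnSn /G /p ascentsS /=.
  by case: (_ < _); rewrite ?addn1 ?addn0 eqxx ?orbT.
case: (ex_minnP exG) => t /andP[tj Gt] tmin {exG}.
(* If i still has p - 1 ascents, then so has t, and the word decreases from t to i, giving w_i <=
   w_t < w_j. Hence every index failing [G] is below t, which bounds the count by t. *)
have up i : t <= i < j -> G i.
  move=> /andP[ti ij]; move: Gt; rewrite /G.
  have := ascents_mono x0 w ti; have := ascents_mono x0 w (ltnW ij).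
  rewrite -/p; have [<- //|ti'] := eqVneq t i.
  have := @ascents_eq_desc _ x0 w t i uw; rewrite sw; lia.
have ct : count (fun i => ~~ G i) (iota 0 j) <= t.
  rewrite -(subnKC (ltnW tj)) iotaD count_cat add0n.
  have /eqP -> : count (fun i => ~~ G i) (iota t (j - t)) == 0.
    rewrite -leqn0 leqNgt -has_count; apply/hasPn => i.
    by rewrite mem_iota subnKC ?(ltnW tj) // => tij; rewrite /= (up i tij).
  by rewrite addn0 (leq_trans (count_size _ _)) ?size_iota.
apply: leq_ltn_trans ct _; rewrite ltnNge; apply/negP => gt.
have tjn : t < j < n by rewrite tj.
have := ordw t j tjn gt; case: t => [|t] /= in Gt tmin up tj tjn gt *.
  (* At t = 0 the previous letter is the initial n, so w_j < w_0; but p > 0 and [G 0] force w_0 <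
     w_j. *)
  rewrite ltn_ord => -[/(_ isT) /andP[lt _] _]; move: Gt.
  by rewrite /G {1 2}/ascents /=; lia.
have nGt : ~~ G t by apply/negP => Gt'; have := tmin t; rewrite Gt' andbT; lia.
rewrite (nth_map x0) ?sw; last by lia.
have neq : (nth x0 w t : nat) != nth x0 w j.
  by apply: nth_ord_neq; rewrite ?sw; lia.
have tj' : t.+1 <= j by lia.
have := ascents_mono x0 w tj'; move: Gt nGt; rewrite /G ascentsS -/p.
by move=> ? ? ? []; lia.
Qed.

(** * Running the insertion procedure *)

(** Loop invariant. Later insertions preserve areas and old inversions, so the last two clauses hold
    for every label inserted so far and at i = n describe the final path. *)
Lemma psi_prefix (n : nat) (g : PF n) (x0 : 'I_n) (i : nat) :
  let w := pmaj_word g in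
  i <= n ->
  exists P, [/\ foldl (fun oP l => obind (fun P => psi_step g P l) oP)
                  (Some [::]) (take i w) = Some P,
    valid_path P, perm_eq (labels P) (take i w),
    forall j, j < i -> area P (nth x0 w j) = ascents x0 w j
  & forall j, j < i -> count (fun m => ~~ dinv P m (nth x0 w j)) (take j w)
      = g (nth x0 w j)].
Proof.
move=> w; have [sw uw gw _] := pmaj_wordP g x0; rewrite -/w in sw uw gw.
elim: i => [|i IH] iltn.
  by exists [::]; rewrite take0; split.
have [P [foldP vP permL areaP dinvP]] := IH (ltnW iltn).
have iw : i < size w by rewrite sw.
have memP y : y \in labels P -> exists2 j, j < i & y = nth x0 w j.
  rewrite (perm_mem permL) => /(nthP x0)[j].
  rewrite size_takel ?(ltnW iw) // => ji.
  by rewrite nth_take // => <-; exists j.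
set l := nth x0 w i; set p := ascents x0 w i.
have neq j : j < i -> nth x0 w j != l.
  by move=> ji; rewrite nth_uniq ?sw // ?(ltn_eqF ji) // (ltn_trans ji).
have nl : l \notin labels P.
  by apply/negP => /memP[j /neq + lE]; rewrite -lE eqxx.
have top y : y \in labels P -> area P y <= p /\ (area P y = p -> l < y).
  move=> /memP[j ji ->]; rewrite areaP //; split; first exact/ascents_mono/ltnW.
  exact: ascents_eq_desc.
have sP : size (labels P) = i by rewrite (perm_size permL) size_takel // ltnW.
have cle : g l <= size (labels P) by rewrite sP gw.
have takeE k : k <= n -> take k w = [seq nth x0 w j | j <- iota 0 k].
  by move=> kn; rewrite map_nth_iota0 // sw.
(* The areas equal the ascent numbers, which turns [pmaj_value_gt] into the lower bound on g(l) that
   the insertion requires. *)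
have pc : p = 0 \/ count (fun x => ~~ good P p l x) (labels P) < g l.
  case: (posnP p) => [->|p0]; [by left|right].
  rewrite (permP permL) takeE ?(ltnW iltn) // count_map.
  rewrite (eq_in_count (a2 := fun k => ~~ ((ascents x0 w k == p)
      || ((ascents x0 w k).+1 == p) && (nth x0 w k < l)))).
    exact: pmaj_value_gt.
  by move=> j; rewrite mem_iota add0n /= => ji; rewrite /good areaP.
have [A [B [defP hA step avA ptsA]]] := unique_insertion vP nl top cle pc.
have asc : pmaj_asc g l = p by apply: pmaj_asc_nth.
move: (vP) (nl) (step); rewrite {1 2}defP => vP' nl' /(valid_insert vP' nl') vQ.
have lA : Some l \notin A.
  by move: nl'; rewrite labels_cat mem_cat mem_labels; case/norP.
exists (A ++ [:: Some l; None] ++ B); split=> //.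
- rewrite (take_nth x0) // foldl_rcons foldP /= /psi_step /insertion_points asc.
  by rewrite ptsA -insert_at_cat -defP.
- rewrite labels_insert (take_nth x0) // -cats1 -/l.
  rewrite -[l :: labels B]cat1s perm_catCA perm_sym perm_catC perm_sym.
  by rewrite perm_cat2l -labels_cat -defP.
- move=> j; rewrite ltnS leq_eqVlt => /predU1P[->|ji].
    by rewrite area_inserted // hA addKn.
  by rewrite area_insert ?neq // -defP areaP.
move=> j; rewrite ltnS leq_eqVlt => /predU1P[->|ji].
  rewrite -/l -avA /avoided defP insert_at_cat -defP.
  by apply/esym/permP.
rewrite -dinvP //; apply: eq_in_count => y; rewrite takeE; last by lia.
case/mapP=> k; rewrite mem_iota add0n => /= kj ->.
rewrite dinv_insert ?defP ?neq //.
exact: ltn_trans ji.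
Qed.

(** * Passing between parking functions and paths *)

Lemma count_None_Some (n : nat) (s : seq 'I_n) :
  count_mem None [seq Some l | l <- s] = 0.
Proof. by elim: s. Qed.

Lemma col_path_of (n : nat) (f : {ffun 'I_n -> 'I_n}) (l : 'I_n) :
  col (path_of f) l = f l.
Proof.
(* Reading [f l] as an index lets the list of columns be generalized while the enumeration of labels
   inside each column stays fixed. *)
rewrite -[RHS]index_enum_ord /path_of.
have: f l \in enum 'I_n by rewrite mem_enum.
have Some_inj : injective (@Some 'I_n) by move=> ? ? [].
elim: {1 3 4}(enum 'I_n) => // i s IH.
rewrite inE /= col_cat mem_rcons inE /= mem_map // mem_filter mem_enum andbT.
rewrite [i == _]eq_sym; case: eqP => [<- _|_ /= /IH ->] /=.
  rewrite -cats1 col_cat mem_map // mem_filter eqxx mem_enum; apply/eqP.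
  by rewrite -leqn0 -(count_None_Some [seq x <- enum 'I_n | f x == f l]) col_le.
by rewrite -cats1 count_cat count_None_Some.
Qed.

Lemma enum_ord_sorted (n : nat) (a : pred 'I_n) :
  sorted (fun x y : 'I_n => x < y) (filter a (enum 'I_n)).
Proof.
apply: sorted_filter; first by move=> ? ? ?; apply: ltn_trans.
have : sorted ltn (map val (enum 'I_n)) by rewrite val_enum_ord iota_ltn_sorted.
by rewrite sorted_map.
Qed.

(** Induction on the number of columns, cutting at the first east step; j is the number of columns
    already removed. The labels of the first column increase strictly, so they agree with the
    filtered enumeration as soon as they have the same members. *)
Lemma columns_decomposition (n : nat) (f : 'I_n -> nat) (P : lpath n)
    (j k : nat) :
    uniq (labels P) -> sorted (@column_step n) P -> last None P = None ->
    count_mem None P = k ->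
    (forall l, l \in labels P -> f l = j + col P l) ->
  P = flatten [seq rcons [seq Some l | l <- enum 'I_n
                         & (l \in labels P) && (f l == i)] None
              | i <- iota j k].
Proof.
elim: k j P => [|k IH] j P un so la ck fP.
  case/lastP: P la ck {un so fP} => // P x; rewrite last_rcons => ->.
  by rewrite -cats1 count_cat /= addn1.
have NP : None \in P by rewrite -has_pred1 has_count ck.
have [C [P' [defP nC]]] : exists C P', P = C ++ None :: P' /\ None \notin C.
  exists (take (index None P) P), (drop (index None P).+1 P).
  rewrite -[X in X :: _](nth_index None NP) -drop_nth ?index_mem //.
  by rewrite cat_take_drop in_take // ltnn.
have CE : C = [seq Some l | l <- labels C].
  by elim: C nC {defP} => //= -[x|] C IHC; rewrite inE //= => /IHC <-.
have C0 : count_mem None C = 0 by rewrite CE count_None_Some.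
have defL : labels P = labels C ++ labels P' by rewrite defP labels_cat.
have fC l : l \in labels C -> f l = j.
  move=> lC; rewrite fP ?defL ?mem_cat ?lC // defP col_cat -mem_labels lC.
  by have := col_le C l; rewrite C0; lia.
have fP' l : l \in labels P' -> f l = j.+1 + col P' l.
  move=> lP'; rewrite fP ?defL ?mem_cat ?lP' ?orbT //.
  have /negPf lC : l \notin labels C.
    by move: un; rewrite defL cat_uniq => /and3P[_ /hasPn + _]; apply.
  by rewrite defP col_cat -mem_labels lC C0 col_cons /= add0n addnA addn1.
have defC : labels C = [seq l <- enum 'I_n | (l \in labels P) && (f l == j)].
  apply: (irr_sorted_eq (leT := fun x y : 'I_n => x < y)).
  - by move=> ? ? ?; apply: ltn_trans.
  - by move=> ?; apply: ltnn.
  - move: so; rewrite defP => /cat_sorted2[+ _]; rewrite {1}CE sorted_map.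
    by apply: sub_sorted.
  - exact: enum_ord_sorted.
  move=> l; rewrite mem_filter mem_enum andbT defL mem_cat.
  case: (boolP (l \in labels C)) => [/fC -> |_] /=; first by rewrite eqxx.
  by case: (boolP (l \in labels P')) => //= /fP' ->; lia.
rewrite /= -defC -CE cat_rcons {1}defP; congr (_ ++ None :: _).
rewrite {1}[P'](IH j.+1); first last.
- exact: fP'.
- by move: ck; rewrite defP count_cat C0 /= => -[].
- by move: la; rewrite defP last_cat.
- by move: so; rewrite defP => /cat_sorted2[_ /path_sorted].
- by move: un; rewrite defL cat_uniq => /and3P[].
congr flatten; apply/eq_in_map => i; rewrite mem_iota => /andP[ij _].
congr rcons; congr map; apply: eq_filter => l; rewrite defL mem_cat.
case: (boolP (l \in labels C)) => [/fC ->|] //=.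
by rewrite (ltn_eqF ij) andbF.
Qed.

Lemma valid_last (n : nat) (P : lpath n) : valid_path P -> last None P = None.
Proof.
case/lastP: P => // P [x|] vP; rewrite last_rcons //.
move: (vP); rewrite -cats1 => /valid_prefix.
by case: vP; rewrite -cats1 !count_cat /=; lia.
Qed.

Lemma valid_path_of (n : nat) (P : lpath n) :
    valid_path P -> (forall l, l \in labels P) ->
  exists f : PF n, path_of f = P.
Proof.
move=> vP full; have [eqc pre un so] := vP.
have cS : count isSome P = n.
  rewrite -size_labels -(card_uniqP un) -[RHS]card_ord; apply: eq_card => l.
  by rewrite full.
have lt l : col P l < n.
  apply: leq_ltn_trans (valid_col_row l vP) _; rewrite -[ltnRHS]cS row_lt //.
  by rewrite -mem_labels.
pose f := [ffun l => Ordinal (lt l)].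
have fP : parking f.
  apply/forallP => m.
  (* Take the shortest prefix with m east steps. It has at least m north steps, and by minimality
     their labels all have column below m. *)
  have exk : exists k, m <= xcoord P k.
    by exists (size P); rewrite /xcoord take_size eqc cS -ltnS.
  case: (ex_minnP exk) => k mk kmin.
  apply: leq_trans (leq_trans mk (pre k)) _.
  rewrite /ycoord -size_labels.
  have uk : uniq (labels (take k P)).
    move: un; rewrite -{1}(cat_take_drop k P) labels_cat cat_uniq.
    by case/and3P.
  rewrite -(card_uniqP uk); apply/subset_leq_card/subsetP => l.
  rewrite mem_labels inE ffunE /= in_take -?mem_labels // ltnNge => lk.
  by rewrite ltnNge; apply: contra lk => /kmin.
exists (Park fP); rewrite /= /path_of.
rewrite [RHS](columns_decomposition (f := col P) (j := 0) (k := n) un so) //.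
- rewrite -[in RHS]val_enum_ord -[in RHS]map_comp; congr flatten.
  apply: eq_map => i /=.
  congr rcons; congr map; apply: eq_filter => l.
  by rewrite full ffunE -val_eqE.
- exact: valid_last.
- by rewrite eqc.
Qed.

(** * The dinv reading word and the values of phi *)

Lemma row_neq (n : nat) (P : lpath n) (x y : 'I_n) :
  uniq (labels P) -> x \in labels P -> y \in labels P -> x != y ->
  row P x != row P y.
Proof.
move=> un; rewrite !mem_labels => xP yP xy.
have [A [B [defP xA]]] := label_split un xP.
have /negPf xy' : Some x != Some y by apply: contraNneq xy => -[->].
rewrite defP !row_cat (negPf xA) !row_cons eqxx xy' /= addn0.
by case: ifP => [/row_lt|_]; lia.
Qed.

Lemma card_before (T : finType) (w : seq T) (a : pred T) (l : T) :
  uniq w -> (forall x, x \in w) ->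
  count a (take (index l w) w) = #|[set x | a x & index x w < index l w]|.
Proof.
move=> uw full; rewrite -size_filter.
have uf : uniq (filter a (take (index l w) w)).
  by rewrite filter_uniq ?take_uniq.
rewrite -(card_uniqP uf); apply: eq_card => x.
by rewrite inE mem_filter in_take.
Qed.

(** Area and column add up to the row, and rows are distinct, so [precedes] separates any two labels
    and sorting yields a strict order of positions. *)
Lemma precedes_index (n : nat) (f : {ffun 'I_n -> 'I_n}) (l m : 'I_n) :
  valid_path (path_of f) -> (forall x, x \in labels (path_of f)) -> l != m ->
  (index l (dinv_word f) < index m (dinv_word f)) = precedes f l m.
Proof.
set P := path_of f => vP full lm; have [_ _ un _] := vP.
have rowE x : row P x = area P x + f x.
  by rewrite -(col_path_of f x) subnK // valid_col_row.
have neq x y : x != y -> area P x + f x != area P y + f y.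
  by move=> xy; rewrite -!rowE row_neq.
set r := fun x y : 'I_n => (x == y) || precedes f x y.
have r_trans : transitive r.
  move=> y x z; rewrite /r /precedes -/P.
  case: (x =P y) => [-> //|_] /=; case: (y =P z) => [-> -> //|_] /=.
    by rewrite orbT.
  by move=> H1 H2; apply/orP; right; lia.
have r_total : total r.
  move=> x y; rewrite /r /precedes -/P; case: (eqVneq x y) => //= xy.
  by have := neq x y xy; lia.
have memw x : x \in dinv_word f by rewrite mem_sort mem_enum.
have srt : sorted r (dinv_word f) by apply: sort_sorted.
have lt_r x y : index x (dinv_word f) < index y (dinv_word f) -> r x y.
  exact: sorted_ltn_index.
apply/idP/idP => [/lt_r|lm']; first by rewrite /r (negPf lm).
case: ltngtP => // [/lt_r|/index_inj lmE].
  rewrite /r eq_sym (negPf lm) /=; move: lm'; rewrite /precedes; lia.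
by rewrite lmE ?eqxx // in lm.
Qed.

(** Subtracting the inverted predecessors from the position leaves the predecessors that avoid l. *)
Lemma phi_value (n : nat) (f : {ffun 'I_n -> 'I_n}) (l : 'I_n) :
  index l (dinv_word f) - dinv_before f l =
  #|[set m | ~~ dinv (path_of f) m l
           & index m (dinv_word f) < index l (dinv_word f)]|.
Proof.
have uw : uniq (dinv_word f) by rewrite sort_uniq enum_uniq.
have memw x : x \in dinv_word f by rewrite mem_sort mem_enum.
rewrite -(card_before (fun m => ~~ dinv _ m l)) //.
rewrite -[X in X - _](size_takel (index_size l (dinv_word f))).
rewrite -(count_predC (fun m => dinv (path_of f) m l)) addKn.
by apply: eq_count.
Qed.

(** * The two maps are mutually inverse *)

Lemma psi_partial_phi (n : nat) (g : PF n) :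
  0 < n -> exists f : PF n, psi_partial g = Some f /\ phi f = g.
Proof.
move=> hn; pose x0 := Ordinal hn.
have [sw uw _ _] := pmaj_wordP g x0; set w := pmaj_word g in sw uw.
have [P [foldP vP permL areaP dinvP]] := psi_prefix g x0 (leqnn n).
rewrite -/w in foldP permL areaP dinvP.
rewrite -[X in take X]sw take_size in foldP permL.
have memw l : l \in w.
  have sub : {subset w <= enum 'I_n} by move=> x _; rewrite mem_enum.
  have sz : size (enum 'I_n) <= size w by rewrite sw size_enum_ord.
  by have [_ ->] := uniq_min_size uw sub sz; rewrite mem_enum.
have full l : l \in labels P by rewrite (perm_mem permL).
have [f0 f0P] := valid_path_of vP full.
rewrite /psi_partial /psi_path foldP /=.
case: pickP => [f /eqP fP|/(_ f0)]; last by rewrite f0P eqxx.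
exists f; split=> //; apply: val_inj; apply/ffunP => l; apply: val_inj.
rewrite ffunE /= phi_value fP.
pose j := index l w.
have jw : j < n by rewrite -sw index_mem.
have lj : nth x0 w j = l by rewrite nth_index.
(* Both sides now count labels avoiding l, those before l in the dinv word and those before l in the
   pmaj word. *)
have := dinvP j jw; rewrite lj card_before // => <-.
apply: eq_card => m; rewrite !inE; case: (eqVneq m l) => [->|ml].
  by rewrite !ltnn.
rewrite precedes_index ?fP // /precedes fP.
have [_ _ un _] := vP.
have colE x : (f x : nat) = col P x by rewrite -(col_path_of f) fP.
rewrite !colE.
have := row_neq un (full m) (full l) ml.
have := valid_col_row m vP; have := valid_col_row l vP.
rewrite /dinv !full /dinv_lt.
have iw x : index x w < n by rewrite -[ltnRHS]sw index_mem.
have aw x : area P x = ascents x0 w (index x w).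
  by rewrite -areaP ?iw // nth_index.
have ml' : (m : nat) != l by [].
have idx : index m w != index l w.
  by apply: contraNneq ml => /index_inj -> //.
have desc x y : index x w < index y w -> area P x <= area P y
    /\ (area P x = area P y -> y < x).
  move=> lt; rewrite !aw; split; first exact/ascents_mono/ltnW.
  have := @ascents_eq_desc n x0 w (index x w) (index y w) uw lt.
  by rewrite sw iw !nth_index //; apply.
have := desc m l; have := desc l m; rewrite /area => d1 d2.
(* Unequal areas order m and l alike in both words. At equal area, m before l in the pmaj word means
   m > l, so avoiding an inversion puts m to the left; m after l means m < l, and lying to the left
   would be an inversion. *)
case: (ltngtP (index m w) (index l w)) idx => // lt _.
- by have := d2 lt; lia.
- by have := d1 lt; lia.
Qed.

Theorem theorem6p2 (n : nat) (hn : 0 < n) :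
  exists psi : PF n -> PF n,
    (forall g : PF n, psi_partial g = Some (psi g))
    /\ (cancel psi (@phi n) /\ cancel (@phi n) psi).
Proof.
(* [psi_partial] is defined everywhere, so the default [g] only serves to extract its value. *)
exists (fun g => odflt g (psi_partial g)).
have psiP (g : PF n) : psi_partial g = Some (odflt g (psi_partial g)).
  by have [f [->]] := psi_partial_phi g hn.
have psiK : cancel (fun g : PF n => odflt g (psi_partial g)) (@phi n).
  by move=> g /=; have [f [-> ]] := psi_partial_phi g hn.
split=> //; split=> //.
by apply/(bij_can_sym (injF_bij (can_inj psiK))).
Qed.
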